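(* Let $\mathcal D$ and $\mathcal C$ be as in the context, let $X_0$ be a finite alphabet and $X=\Psi X_0$, and let $L:X^*\to Y$ be a regular language. Let $V$ be the smallest subcoalgebra of $\rho\bar T$ containing $L^{\mathrm{rev}}$, pointed by the element $L^{\mathrm{rev}}$ (i.e. $\bar I\to V$ choosing it). Then $V$ is finite and its dual $\mathcal D$-automaton is isomorphic to the minimal $\mathcal D$-automaton for $L$.
   Context: $\mathcal D$ is a commutative (for all $A,B$ the homomorphisms form a subalgebra $[A,B]$ of $B^{|A|}$), locally finite variety of algebras or ordered algebras whose epimorphisms are surjective; $\otimes$ represents bimorphisms and $I=\Psi 1$, $\Psi$ the free-algebra functor. $\mathcal C$ is a locally finite variety of algebras with the finite algebras $\mathcal C_f$ dually equivalent to the finite algebras $\mathcal D_f$ via $Q\mapsto\widehat Q$, $g\mapsto\widehat g$. $\bar I\in\mathcal C$ is the free one-generated algebra, $Y\in\mathcal D_f$ is dual to $\bar I$, $\bar Y\in\mathcal C_f$ is dual to $I$; $|Y|$ and $|\bar Y|$ are identified with $\{0,1\}$. $X^*=\Psi X_0^*$; a language $L:X^*\to Y$ is identified with its restriction $X_0^*\to\{0,1\}$; $L^{\mathrm{rev}}=L\circ\mathrm{rev}$ with $\mathrm{rev}:X^*\to X^*$ extending word reversal. A $\mathcal D$-automaton is $(Q,\delta_a\ (a\in X_0),i:I\to Q,f:Q\to Y)$; its accepted language is $a_1\cdots a_n\mapsto f\delta_{a_n}\cdots\delta_{a_1}i$; $L$ is regular if accepted by one with finite $Q$. The minimal automaton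 for $L$ is the (unique up to iso) automaton accepting $L$ that is reachable (every state is $\delta_w(i)$ for some $w\in X^*$, where $\delta_w$ is the image of $w$ under the $\mathcal D$-monoid morphism $X^*\to[Q,Q]$ extending $a\mapsto\delta_a$) and simple (distinct states accept distinct languages). On $\mathcal C$, $\bar TQ=\bar Y\times Q^{X_0}$ with coalgebras $(Q,\gamma_a,f:Q\to\bar Y)$; a pointed coalgebra additionally has $i:\bar I\to Q$. A finite pointed $\bar T$-coalgebra $(Q,\gamma_a,f,i)$ dualizes to the $\mathcal D$-automaton $(\widehat Q,\widehat{\gamma_a},\widehat f:I\cong\widehat{\bar Y}\to\widehat Q,\widehat i:\widehat Q\to\widehat{\bar I}\cong Y)$. $\rho\bar T$ is the colimit of all finite $\bar T$-coalgebras; its states are the regular languages over $X_0$, with output $K\mapsto[\epsilon\in K]$ and transitions $K\mapsto a^{-1}K=\{w:aw\in K\}$; a subcoalgebra of $\rho\bar T$ is a $\bar T$-coalgebra whose unique homomorphism into $\rho\bar T$ is injective.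
   Formalization: When D is a variety of ordered algebras, ''simple'' means that the map from states to accepted languages (ordered pointwise) is an order embedding; with mere injectivity the minimal automaton is not unique (D = posets, L = a^+). *)

(* Defs.v *)
From HB Require Import structures.
From mathcomp Require Import all_boot.
From mathcomp Require Import boolp classical_sets functions cardinality.

Set Implicit Arguments.
Unset Strict Implicit.
Unset Printing Implicit Defensive.

Local Open Scope classical_set_scope.

Record signature := Signature {
  op : Type;
  ar : op -> nat }.

Inductive term (Sg : signature) (T : Type) : Type :=
| Var of T
| App (o : op Sg) of ('I_(ar o) -> term Sg T).

Fixpoint eval (Sg : signature) (T A : Type)
    (opA : forall o : op Sg, ('I_(ar o) -> A) -> A) (v : T -> A)
    (t : term Sg T) : A :=
  match t with
  | Var x => v x
  | App o ts => opA o (fun i => eval opA v (ts i))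
  end.

(** A variety of ordered algebras is given by inequations [s <= t] between
    finitary terms. A variety of (plain) algebras is the case
    [is_ordered = false]: the order of its algebras is then required to be the
    equality relation ([le_discrete] below), so [s <= t] means [s = t]. *)
Record variety := Variety {
  sig_of :> signature;
  is_ordered : bool;
  ineq : term sig_of nat -> term sig_of nat -> Prop }.

Record alg (V : variety) := Alg {
  car :> Type;
  le : car -> car -> Prop;
  opn : forall o : op V, ('I_(ar o) -> car) -> car;
  le_refl : forall x, le x x;
  le_trans : forall y x z, le x y -> le y z -> le x z;
  le_anti : forall x y, le x y -> le y x -> x = y;
  le_discrete : ~~ is_ordered V -> forall x y, le x y -> x = y;
  opn_mono : forall (o : op V) (u v : 'I_(ar o) -> car),
    (forall i, le (u i) (v i)) -> le (opn u) (opn v);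
  alg_sat : forall s t : term V nat, ineq s t ->
    forall v : nat -> car, le (eval opn v s) (eval opn v t) }.

Section Homs.
Variable V : variety.

Definition is_hom (A B : alg V) (f : A -> B) : Prop :=
  (forall x y, le x y -> le (f x) (f y)) /\
  (forall (o : op V) (u : 'I_(ar o) -> A),
     f (opn u) = opn (fun i => f (u i))).

Record hom (A B : alg V) := Hom { hfun :> A -> B; homP : is_hom hfun }.

Lemma hom_ext (A B : alg V) (f g : hom A B) : f =1 g -> f = g.
Proof.
case: f g => [f fP] [g gP] /= /funext fg; rewrite {}fg in fP *.
by rewrite (Prop_irrelevance fP gP).
Qed.

Lemma is_hom_id (A : alg V) : is_hom (fun x : A => x).
Proof. by split. Qed.
Definition hid (A : alg V) : hom A A := Hom (is_hom_id A).

Lemma is_hom_comp (A B C : alg V) (g : B -> C) (f : A -> B) :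
  is_hom g -> is_hom f -> is_hom (fun x => g (f x)).
Proof.
move=> [g1 g2] [f1 f2]; split=> [x y xy|o u]; first by apply/g1/f1.
by rewrite f2 g2.
Qed.
Definition hcomp (A B C : alg V) (g : hom B C) (f : hom A B) : hom A C :=
  Hom (is_hom_comp (homP g) (homP f)).

Lemma hom_eval (A B : alg V) (f : A -> B) (T : Type) (v : T -> A)
    (t : term V T) : is_hom f ->
  f (eval (@opn _ A) v t) = eval (@opn _ B) (fun x => f (v x)) t.
Proof.
move=> fP; elim: t => //= o ts IH; rewrite fP.2; congr opn.
by apply: funext => i; exact: IH.
Qed.

Record iso (A B : alg V) := Iso {
  fwd : hom A B;
  bwd : hom B A;
  fwdK : cancel fwd bwd;
  bwdK : cancel bwd fwd }.

Definition closed (A : alg V) (P : set A) : Prop :=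
  forall (o : op V) (u : 'I_(ar o) -> A), (forall i, P (u i)) -> P (opn u).

Definition generated (A : alg V) (G : set A) : set A :=
  [set x | forall P : set A, closed P -> G `<=` P -> P x].

Definition locally_finite : Prop :=
  forall (A : alg V) (G : set A),
    finite_set G -> generated G = [set: A] -> finite_set [set: A].

Definition commutative_variety : Prop :=
  forall (A B : alg V) (o : op V) (h : 'I_(ar o) -> hom A B),
    is_hom (fun x => opn (fun i => h i x)).

Definition epi (A B : alg V) (e : hom A B) : Prop :=
  forall (C : alg V) (g h : hom B C), hcomp g e = hcomp h e -> g = h.

Definition epis_surjective : Prop :=
  forall (A B : alg V) (e : hom A B), epi e -> forall y, exists x, e x = y.

Record falg := FAlg {
  falg_alg :> alg V;
  falg_fin : finite_set [set: falg_alg] }.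

Section Sub.
Variables (A : alg V) (P : set A) (clP : closed P).

Let scar := {x : A | P x}.
Let sle (x y : scar) := le (sval x) (sval y).
Let sopn (o : op V) (u : 'I_(ar o) -> scar) : scar :=
  exist _ (opn (fun i => sval (u i))) (clP (fun i => svalP (u i))).

Lemma sval_inj_sub (x y : scar) : sval x = sval y -> x = y.
Proof. by case: x y => [x px] [y py] /= e; exact: eq_exist. Qed.

Let sval_eval (v : nat -> scar) t :
  sval (eval sopn v t) = eval (@opn _ A) (fun n => sval (v n)) t.
Proof. by elim: t => //= o ts IH; congr opn; apply: funext. Qed.

Lemma sub_anti (x y : scar) : sle x y -> sle y x -> x = y.
Proof. by move=> xy yx; apply: sval_inj_sub; exact: le_anti. Qed.
Lemma sub_discrete : ~~ is_ordered V -> forall x y : scar, sle x y -> x = y.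
Proof. by move=> nV x y xy; apply: sval_inj_sub; exact: le_discrete. Qed.
Lemma sub_sat s t : ineq s t ->
  forall v : nat -> scar, sle (eval sopn v s) (eval sopn v t).
Proof. by move=> st v; rewrite /sle !sval_eval; exact: alg_sat. Qed.

Definition sub_alg : alg V :=
  @Alg V scar sle sopn (fun x => le_refl (sval x))
    (fun y x z => @le_trans _ _ (sval y) (sval x) (sval z))
    sub_anti sub_discrete (fun o u v => @opn_mono _ _ _ _ _) sub_sat.

Lemma is_hom_val : is_hom (sval : sub_alg -> A).
Proof. by split. Qed.
Definition sub_val : hom sub_alg A := Hom is_hom_val.

Lemma is_hom_lift (B : alg V) (f : hom B A) (fP : forall x, P (f x)) :
  is_hom (fun x => exist _ (f x) (fP x) : sub_alg).
Proof.
split=> [x y /(homP f).1 //|o u]; apply: sval_inj_sub => /=.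
by rewrite (homP f).2.
Qed.

End Sub.

Lemma closed_generated (A : alg V) (G : set A) : closed (generated G).
Proof. by move=> o u uG P clP GP; apply: (clP) => i; exact: uG. Qed.

Lemma sub_generated (A : alg V) (G : set A) : G `<=` generated G.
Proof. by move=> x Gx P _; exact. Qed.

Section Free.
Variable T : Type.

Definition tle (s t : term V T) : Prop :=
  forall (A : alg V) (v : T -> A), le (eval (@opn _ A) v s) (eval (@opn _ A) v t).
Definition teq (s t : term V T) : Prop := tle s t /\ tle t s.

Lemma teqP s t : teq s t <->
  forall (A : alg V) (v : T -> A), eval (@opn _ A) v s = eval (@opn _ A) v t.
Proof.
split=> [[st ts] A v|st]; first by apply: le_anti; [exact: st|exact: ts].
by split=> A v; rewrite st; exact: le_refl.
Qed.

Definition psi_car := {P : set (term V T) | exists t, P = [set s | teq s t]}.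
Definition cls (t : term V T) : psi_car :=
  exist _ [set s | teq s t] (ex_intro _ t erefl).
Definition rep (x : psi_car) : term V T := sval (cid (svalP x)).

Lemma cls_eq s t : teq s t -> cls s = cls t.
Proof.
move=> /teqP st; apply: eq_exist; apply/funext => r /=.
by apply/propext; split=> /teqP e; apply/teqP => A v; rewrite e st.
Qed.

Lemma repK : cancel rep cls.
Proof.
move=> x; case: x => P eP; apply: eq_exist => /=.
by rewrite /rep; case: (cid _).
Qed.

Lemma rep_cls t : teq (rep (cls t)) t.
Proof.
rewrite /rep; case: (cid _) => s /= e.
have : [set r | teq r t] t by apply/teqP.
by rewrite e => /teqP es; apply/teqP => A v; rewrite es.
Qed.

Lemma eval_rep_cls t (A : alg V) (v : T -> A) :
  eval (@opn _ A) v (rep (cls t)) = eval (@opn _ A) v t.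
Proof. by have /teqP := rep_cls t. Qed.

Definition psi_le (x y : psi_car) : Prop := tle (rep x) (rep y).
Definition psi_opn (o : op V) (u : 'I_(ar o) -> psi_car) : psi_car :=
  cls (App (fun i => rep (u i))).

Lemma psi_le_anti x y : psi_le x y -> psi_le y x -> x = y.
Proof. by move=> xy yx; rewrite -[x]repK -[y]repK; exact: cls_eq. Qed.

Lemma psi_le_discrete : ~~ is_ordered V -> forall x y, psi_le x y -> x = y.
Proof.
move=> nV x y xy; apply: psi_le_anti => // A v.
by rewrite -(le_discrete nV (xy A v)); exact: le_refl.
Qed.

Lemma psi_opn_mono (o : op V) (u v : 'I_(ar o) -> psi_car) :
  (forall i, psi_le (u i) (v i)) -> psi_le (psi_opn u) (psi_opn v).
Proof.
by move=> uv A w; rewrite !eval_rep_cls; apply: opn_mono => i; exact: uv.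
Qed.

Lemma eval_psi (w : nat -> psi_car) s (A : alg V) (v : T -> A) :
  eval (@opn _ A) v (rep (eval psi_opn w s)) =
  eval (@opn _ A) (fun n => eval (@opn _ A) v (rep (w n))) s.
Proof.
elim: s => //= o ts IH; rewrite eval_rep_cls /=; congr opn.
by apply: funext => i; exact: IH.
Qed.

Lemma psi_sat s t : ineq s t ->
  forall w, psi_le (eval psi_opn w s) (eval psi_opn w t).
Proof. by move=> st w A v; rewrite !eval_psi; exact: alg_sat. Qed.

(** The free algebra on [T]: terms modulo the (in)equalities valid in [V]. *)
Definition Psi : alg V :=
  @Alg V psi_car psi_le psi_opn (fun x A v => le_refl _)
    (fun y x z xy yz A v => le_trans (xy A v) (yz A v))
    psi_le_anti psi_le_discrete psi_opn_mono psi_sat.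

Definition eta (x : T) : Psi := cls (Var V x).

Lemma is_hom_ext (A : alg V) (g : T -> A) :
  is_hom (fun x : Psi => eval (@opn _ A) g (rep x)).
Proof. by split=> [x y xy|o u]; [exact: xy|rewrite eval_rep_cls]. Qed.
Definition ext (A : alg V) (g : T -> A) : hom Psi A := Hom (is_hom_ext g).

Lemma ext_eta (A : alg V) (g : T -> A) x : ext g (eta x) = g x.
Proof. by rewrite /= eval_rep_cls. Qed.

Lemma psi_eval_eta t : eval (@opn _ Psi) eta t = cls t.
Proof.
elim: t => //= o ts IH; rewrite /psi_opn; apply: cls_eq; apply/teqP => A v /=.
by congr opn; apply: funext => i; rewrite IH eval_rep_cls.
Qed.

Lemma psi_uniq (A : alg V) (f g : Psi -> A) : is_hom f -> is_hom g ->
  (forall x, f (eta x) = g (eta x)) -> f =1 g.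
Proof.
move=> fP gP fg x; rewrite -[x]repK -psi_eval_eta !hom_eval//.
by congr eval; apply: funext.
Qed.

Lemma ext_unique (A : alg V) (g : T -> A) (h : hom Psi A) :
  (forall x, h (eta x) = g x) -> h = ext g.
Proof.
move=> hg; apply: hom_ext; apply: psi_uniq => [||x]; try exact: homP.
by rewrite ext_eta.
Qed.

Lemma psi_generated : generated (range eta) = [set: Psi].
Proof.
rewrite predeqE => x; split=> // _ P clP etaP.
rewrite -[x]repK -psi_eval_eta; elim: (rep x) => [y|o ts IH] /=.
  by apply: etaP; exists y.
exact: clP.
Qed.

Lemma psi_finite : locally_finite -> finite_set [set: T] ->
  finite_set [set: Psi].
Proof.
by move=> lf fT; apply: lf psi_generated; exact: finite_image.
Qed.

End Free.

Lemma finite_unit : finite_set [set: unit].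
Proof. exact: finite_finset. Qed.

Definition free1 (lf : locally_finite) : falg := FAlg (psi_finite lf finite_unit).

Section HomAlg.
Hypothesis comm : commutative_variety.
Variables A B : alg V.

Definition hom_le (f g : hom A B) : Prop := forall x, le (f x) (g x).
Definition hom_opn (o : op V) (h : 'I_(ar o) -> hom A B) : hom A B :=
  Hom (comm h).

Lemma hom_le_anti f g : hom_le f g -> hom_le g f -> f = g.
Proof. by move=> fg gf; apply: hom_ext => x; apply: le_anti. Qed.
Lemma hom_le_discrete : ~~ is_ordered V -> forall f g, hom_le f g -> f = g.
Proof. by move=> nV f g fg; apply: hom_ext => x; exact: le_discrete. Qed.
Lemma hom_opn_mono (o : op V) (u v : 'I_(ar o) -> hom A B) :
  (forall i, hom_le (u i) (v i)) -> hom_le (hom_opn u) (hom_opn v).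
Proof. by move=> uv x; apply: opn_mono => i; exact: uv. Qed.
Lemma hom_sat s t : ineq s t ->
  forall w, hom_le (eval hom_opn w s) (eval hom_opn w t).
Proof.
move=> st w x.
have ev r : eval hom_opn w r x = eval (@opn _ B) (fun n => w n x) r.
  by elim: r => //= o ts IH; congr opn; apply: funext.
by rewrite !ev; exact: alg_sat.
Qed.

Definition hom_alg : alg V :=
  @Alg V (hom A B) hom_le hom_opn (fun f x => le_refl _)
    (fun g f h fg gh x => le_trans (fg x) (gh x))
    hom_le_anti hom_le_discrete hom_opn_mono hom_sat.

End HomAlg.

(** The multiplication is a bimorphism, which is the same as a morphism on the
    tensor product; the unit is the image of the generator of [Psi unit]. *)
Record dmonoid := DMonoid {
  dm_alg :> alg V;
  dm_mul : dm_alg -> dm_alg -> dm_alg;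
  dm_one : dm_alg;
  dm_mulA : associative dm_mul;
  dm_mul1 : left_id dm_one dm_mul;
  dm_mulr1 : right_id dm_one dm_mul;
  dm_homl : forall y, is_hom (fun x => dm_mul x y);
  dm_homr : forall x, is_hom (dm_mul x) }.

Record dmonoid_hom (M N : dmonoid) := DMonoidHom {
  dmh :> hom M N;
  dmh_one : dmh (dm_one M) = dm_one N;
  dmh_mul : forall x y, dmh (dm_mul x y) = dm_mul (dmh x) (dmh y) }.

Section Monoids.
Hypothesis comm : commutative_variety.

(** [[A, A]] with composition in diagrammatic order, so that the word
    [a_1 ... a_n] acts by applying [a_1] first. *)
Section EndMon.
Variable A : alg V.
Let E := hom_alg comm A A.
Definition end_mul (f g : E) : E := hcomp g f.
Lemma end_mulA : associative end_mul.
Proof. by move=> f g h; exact: hom_ext. Qed.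
Lemma end_mul1 : left_id (hid A : E) end_mul.
Proof. by move=> f; exact: hom_ext. Qed.
Lemma end_mulr1 : right_id (hid A : E) end_mul.
Proof. by move=> f; exact: hom_ext. Qed.
Lemma end_homl (g : E) : is_hom (fun f : E => end_mul f g).
Proof.
split=> [f f' ff' x|o u]; first exact/(homP g).1/ff'.
by apply: hom_ext => x /=; rewrite (homP g).2.
Qed.
Lemma end_homr (f : E) : is_hom (end_mul f).
Proof. by split=> [g g' gg' x|o u]; [exact: gg'|exact: hom_ext]. Qed.
Definition end_mon : dmonoid :=
  DMonoid end_mulA end_mul1 end_mulr1 end_homl end_homr.
End EndMon.

(** [Psi (seq T)], with the multiplication extending concatenation of words. *)
Section WordMon.
Variable T : Type.
Let W := Psi (seq T).
Definition word_act : hom W (hom_alg comm W W) :=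
  @ext (seq T) (hom_alg comm W W) (fun x => ext (fun y => eta (x ++ y))).
Definition word_mul (u v : W) : W := word_act u v.
Lemma word_mul_eta x y : word_mul (eta x) (eta y) = eta (x ++ y).
Proof. by rewrite /word_mul /word_act ext_eta ext_eta. Qed.
Lemma word_homr u : is_hom (word_mul u).
Proof. exact: homP. Qed.
Lemma word_homl v : is_hom (fun u => word_mul u v).
Proof.
split=> [u u' /(homP word_act).1 uu'|o w]; first exact: uu'.
by rewrite /word_mul (homP word_act).2.
Qed.
Lemma word_mulA : associative word_mul.
Proof.
move=> u v w; move: u.
apply: psi_uniq => [||x].
- exact: word_homl.
- exact: is_hom_comp (word_homl w) (word_homl v).
move: v; apply: psi_uniq => [||y].
- exact: is_hom_comp (word_homr _) (word_homl _).
- exact: is_hom_comp (word_homl w) (word_homr _).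
move: w; apply: psi_uniq => [||z].
- exact: is_hom_comp (word_homr _) (word_homr _).
- exact: word_homr.
by rewrite !word_mul_eta catA.
Qed.
Lemma word_mul1 : left_id (eta [::]) word_mul.
Proof.
apply: psi_uniq => [||x]; [exact: word_homr|exact: is_hom_id|].
by rewrite word_mul_eta.
Qed.
Lemma word_mulr1 : right_id (eta [::]) word_mul.
Proof.
apply: psi_uniq => [||x]; [exact: word_homl|exact: is_hom_id|].
by rewrite word_mul_eta cats0.
Qed.
Definition word_mon : dmonoid :=
  DMonoid word_mulA word_mul1 word_mulr1 word_homl word_homr.
End WordMon.

End Monoids.

End Homs.

Arguments hid {V} A.
Arguments Psi V T : clear implicits.
Arguments eta V {T} x.

Record dual_equivalence (C D : variety) := DualEquivalence {
  F0 : falg C -> falg D;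
  F1 : forall A B : falg C, hom A B -> hom (F0 B) (F0 A);
  F1_id : forall A : falg C, F1 (hid A) = hid (F0 A);
  F1_comp : forall (A1 A2 A3 : falg C) (g : hom A2 A3) (f : hom A1 A2),
    F1 (hcomp g f) = hcomp (F1 f) (F1 g);
  G0 : falg D -> falg C;
  G1 : forall A B : falg D, hom A B -> hom (G0 B) (G0 A);
  G1_id : forall A : falg D, G1 (hid A) = hid (G0 A);
  G1_comp : forall (A1 A2 A3 : falg D) (g : hom A2 A3) (f : hom A1 A2),
    G1 (hcomp g f) = hcomp (G1 f) (G1 g);
  unit_iso : forall A : falg C, iso A (G0 (F0 A));
  unit_nat : forall (A B : falg C) (f : hom A B),
    hcomp (fwd (unit_iso B)) f = hcomp (G1 (F1 f)) (fwd (unit_iso A));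
  counit_iso : forall A : falg D, iso A (F0 (G0 A));
  counit_nat : forall (A B : falg D) (f : hom A B),
    hcomp (fwd (counit_iso B)) f = hcomp (F1 (G1 f)) (fwd (counit_iso A)) }.

Record bool_carrier (A : Type) := BoolCarrier {
  to_bool :> A -> bool;
  of_bool : bool -> A;
  to_boolK : cancel to_bool of_bool;
  of_boolK : cancel of_bool to_bool }.

(** The carriers of [Y] and [Ybar] are identified with [{0,1}] along the
    canonical bijections |Y| = D(I,Y) = C(Ibar,Ybar) = |Ybar| ([bool_compat]);
    without this condition the two identifications could differ by negation. *)
Record setting := Setting {
  varD : variety;
  varC : variety;
  D_comm : commutative_variety varD;
  D_lf : locally_finite varD;
  D_epi : epis_surjective varD;
  C_unordered : ~~ is_ordered varC;
  C_lf : locally_finite varC;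
  dual : dual_equivalence varC varD;
  Y : falg varD;
  Ybar : falg varC;
  dualI : iso (free1 D_lf) (F0 dual Ybar);
  dualY : iso (F0 dual (free1 C_lf)) Y;
  Y_bool : bool_carrier Y;
  Ybar_bool : bool_carrier Ybar;
  bool_compat : forall h : hom (free1 C_lf) Ybar,
    Y_bool (fwd dualY (F1 dual h (fwd dualI (eta varD tt)))) =
    Ybar_bool (h (eta varC tt)) }.

Arguments D_comm : clear implicits.
Arguments D_lf : clear implicits.
Arguments D_epi : clear implicits.
Arguments C_lf : clear implicits.

Section Automata.
Variables (S : setting) (X0 : finType).

Notation D := (varD S).
Notation C := (varC S).
Notation Y := (Y S).
Notation Ybar := (Ybar S).
Notation I := (free1 (D_lf S)).
Notation Ibar := (free1 (C_lf S)).

Definition genI : I := eta D tt.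
Definition genIbar : Ibar := eta C tt.

Definition Xstar : dmonoid D := word_mon (D_comm S) X0.

Definition restr (L : hom Xstar Y) (w : seq X0) : bool := Y_bool S (L (eta D w)).

Definition rev_hom : hom Xstar Xstar := ext (fun w : seq X0 => eta D (rev w)).

Definition rev_lang (L : hom Xstar Y) : hom Xstar Y := hcomp L rev_hom.

Record automaton := Automaton {
  st :> alg D;
  delta : X0 -> hom st st;
  ini : hom I st;
  fin : hom st Y }.

Definition run (A : automaton) (q : A) (w : seq X0) : A :=
  foldl (fun q a => delta A a q) q w.

Definition lang (A : automaton) (w : seq X0) : bool :=
  Y_bool S (fin A (run (ini A genI) w)).

Definition regular (K : seq X0 -> bool) : Prop :=
  exists2 A : automaton, finite_set [set: A] & lang A =1 K.

Lemma run_cat (A : automaton) (q : A) u v : run q (u ++ v) = run (run q u) v.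
Proof. exact: foldl_cat. Qed.

Lemma is_hom_run (A : automaton) w : is_hom (fun q : A => run q w).
Proof.
elim: w => [|a w IH]; first exact: is_hom_id.
exact: is_hom_comp IH (homP (delta A a)).
Qed.
Definition run_hom (A : automaton) w : hom A A := Hom (is_hom_run A w).

Definition trans_hom (A : automaton) : hom Xstar (end_mon (D_comm S) A) :=
  @ext D (seq X0) (end_mon (D_comm S) A) (run_hom A).

Lemma trans_homE (A : automaton) w : trans_hom A (eta D w) = run_hom A w.
Proof. exact: ext_eta. Qed.

Lemma trans_one (A : automaton) :
  trans_hom A (dm_one Xstar) = dm_one (end_mon (D_comm S) A).
Proof. by rewrite [LHS]trans_homE; exact: hom_ext. Qed.

Lemma trans_mul (A : automaton) x y : trans_hom A (dm_mul x y) =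
  dm_mul (trans_hom A x) (trans_hom A y).
Proof.
move: x; apply: psi_uniq => [||u].
- exact: is_hom_comp (homP (trans_hom A)) (dm_homl y).
- exact: is_hom_comp (dm_homl (trans_hom A y)) (homP (trans_hom A)).
move: y; apply: psi_uniq => [||v].
- exact: is_hom_comp (homP (trans_hom A)) (@dm_homr _ Xstar (eta D u)).
- exact: is_hom_comp (dm_homr (trans_hom A (eta D u))) (homP (trans_hom A)).
rewrite [X in trans_hom A X]word_mul_eta !trans_homE.
by apply: hom_ext => q /=; rewrite run_cat.
Qed.

(** The morphism [w |-> delta_w]. *)
Definition trans (A : automaton) : dmonoid_hom Xstar (end_mon (D_comm S) A) :=
  DMonoidHom (trans_one A) (@trans_mul A).

Lemma trans_letter (A : automaton) a : trans A (eta D [:: a]) = delta A a.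
Proof. by rewrite [LHS]trans_homE; exact: hom_ext. Qed.

Lemma trans_unique (A : automaton)
    (phi : dmonoid_hom Xstar (end_mon (D_comm S) A)) :
  (forall a, phi (eta D [:: a]) = delta A a) -> phi =1 trans A.
Proof.
move=> phiP; apply: psi_uniq => [||w]; [exact: homP|exact: homP|].
elim: w => [|a w IH].
  by rewrite (dmh_one phi : phi (eta D [::]) = _) (dmh_one (trans A)).
rewrite -cat1s -(word_mul_eta (D_comm S)).
by rewrite (dmh_mul phi) (dmh_mul (trans A)) IH phiP trans_letter.
Qed.

Definition reachable (A : automaton) : Prop :=
  forall q : A, exists w : Xstar, q = (trans A w : hom A A) (ini A genI).

(** If [D] is a variety of algebras, the order is equality and this says that
    distinct states accept distinct languages. If [D] is a variety of ordered
    algebras, the map sending a state to its language (ordered pointwise in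
    [Y]) must be an order embedding: mere injectivity would not determine the
    order on the states, hence not the minimal automaton up to isomorphism. *)
Definition simple (A : automaton) : Prop :=
  forall q q' : A,
    (forall w, le (fin A (run q w)) (fin A (run q' w))) -> le q q'.

Lemma simple_inj (A : automaton) (q q' : A) : simple A ->
  (forall w, fin A (run q w) = fin A (run q' w)) -> q = q'.
Proof.
move=> sA e; apply: le_anti; apply: sA => w; rewrite e; exact: le_refl.
Qed.

Definition minimal_automaton (L : hom Xstar Y) (A : automaton) : Prop :=
  [/\ lang A =1 restr L, reachable A & simple A].

Definition automaton_iso (A B : automaton) : Prop :=
  exists h : iso A B,
    [/\ forall a q, fwd h (delta A a q) = delta B a (fwd h q),
        fwd h (ini A genI) = ini B genI &
        forall q, fin B (fwd h q) = fin A q].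

Definition dfa_rec (K : seq X0 -> bool) : Prop :=
  exists (T : finType) (s0 : T) (d : T -> X0 -> T) (F : T -> bool),
    forall w, K w = F (foldl d s0 w).

Lemma finite_dfa (T : Type) : finite_set [set: T] ->
  forall (q : T) (d : T -> X0 -> T) (F : T -> bool),
  dfa_rec (fun w => F (foldl d q w)).
Proof.
move=> /finite_set_leP[n /pcard_leP/unsquash f] q d F.
have inf : injective f by move=> x y; apply: (@inj _ _ _ f); rewrite inE.
have fn x : f x < n by have := @funS _ _ _ _ f x; apply.
pose f' (x : T) : 'I_n := Ordinal (fn x).
have [g gK] : exists g, cancel f' g.
  exists (fun i => if pselect (exists x, f' x = i) is left e then sval (cid e)
                   else q) => x.
  case: pselect => [e|[]]; last by exists x.
  by case: (cid e) => y /= /(congr1 val)/inf.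
exists 'I_n, (f' q), (fun i a => f' (d (g i) a)), (fun i => F (g i)) => w.
congr F; elim: w q => [|a w IH] x /=; first by rewrite gK.
by rewrite gK -IH.
Qed.

Lemma regular_dfa K : regular K <-> dfa_rec K.
Proof.
split.
  move=> [A fA AK].
  have [T [s0 [d [F KF]]]] := finite_dfa fA (ini A genI)
    (fun q a => delta A a q) (fun q => Y_bool S (fin A q)).
  by exists T, s0, d, F => w; rewrite -AK -KF.
move=> [T [s0 [d [F KF]]]].
pose A := @Automaton (Psi D T) (fun a => ext (fun q => eta D (d q a)))
  (ext (fun=> eta D s0)) (ext (fun q => of_bool (Y_bool S) (F q))).
exists A; first by apply: psi_finite; [exact: D_lf|exact: finite_finset].
move=> w; rewrite KF /lang.
have -> : ini A genI = eta D s0 by exact: ext_eta.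
have -> : run (eta D s0 : A) w = eta D (foldl d s0 w).
  have: forall q, run (eta D q : A) w = eta D (foldl d q w); last exact.
  elim: w => // a w IH q; rewrite -[RHS]IH; congr (run _ w).
  exact: (ext_eta (fun q => eta D (d q a)) q).
by rewrite [fin A _]ext_eta of_boolK.
Qed.

Lemma regular_ext K K' : K =1 K' -> regular K -> regular K'.
Proof. by move=> KK' [A fA AK]; exists A => // w; rewrite AK. Qed.

Lemma regular_deriv K (a : X0) : regular K -> regular (fun w => K (a :: w)).
Proof.
move=> [A fA AK].
by exists (Automaton (delta A) (hcomp (delta A a) (ini A)) (fin A)) => // w;
  rewrite -AK.
Qed.

Lemma regular_rev K : regular K -> regular (fun w => K (rev w)).
Proof.
move=> /regular_dfa[T [s0 [d [F KF]]]]; apply/regular_dfa.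
exists {ffun T -> bool}, [ffun q => F q],
  (fun (P : {ffun T -> bool}) a => [ffun q => P (d q a)]),
  (fun P : {ffun T -> bool} => P s0) => w.
rewrite KF.
elim/last_ind: w s0 {KF} => [|w a IH] s0; first by rewrite /= ffunE.
by rewrite rev_rcons -cats1 foldl_cat /= ffunE -IH.
Qed.

Lemma regular_bool n (p : ('I_n -> bool) -> bool) (K : 'I_n -> seq X0 -> bool) :
  (forall i, regular (K i)) -> regular (fun w => p (fun i => K i w)).
Proof.
move=> rK; apply/regular_dfa.
have {}rK i : dfa_rec (K i) := (regular_dfa (K i)).1 (rK i).
pose T i := projT1 (cid (rK i)); pose r1 i := projT2 (cid (rK i)).
pose s0 i : T i := projT1 (cid (r1 i)); pose r2 i := projT2 (cid (r1 i)).
pose d i : T i -> X0 -> T i := projT1 (cid (r2 i)).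
pose r3 i := projT2 (cid (r2 i)).
pose F i : T i -> bool := projT1 (cid (r3 i)).
have KE i w : K i w = F i (foldl (d i) (s0 i) w) := projT2 (cid (r3 i)) w.
exists {dffun forall i, T i}, [ffun i => s0 i],
  (fun (s : {dffun forall i, T i}) a => [ffun i => d i (s i) a]),
  (fun s : {dffun forall i, T i} => p (fun i => F i (s i))) => w.
congr p; apply: funext => i; rewrite KE; congr (F i _).
suff -> : forall s : {dffun forall i, T i},
  foldl (fun (s : {dffun forall i, T i}) a => [ffun i => d i (s i) a]) s w i
  = foldl (d i) (s i) w by rewrite ffunE.
by elim: w => //= a w IH s; rewrite IH ffunE.
Qed.

Lemma restr_rev (L : hom Xstar Y) w : restr (rev_lang L) w = restr L (rev w).
Proof.
by congr (Y_bool S (L _)); exact: (ext_eta (fun u : seq X0 => eta D (rev u)) w).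
Qed.

Lemma regular_rev_lang L : regular (restr L) -> regular (restr (rev_lang L)).
Proof.
by move=> /regular_rev; apply: regular_ext => w; rewrite restr_rev.
Qed.

Record coalg := Coalg {
  cst :> alg C;
  gam : X0 -> hom cst cst;
  out : hom cst Ybar }.

Record coalg_hom (Q R : coalg) := CoalgHom {
  ch :> hom Q R;
  ch_gam : forall a q, ch (gam Q a q) = gam R a (ch q);
  ch_out : forall q, out R (ch q) = out Q q }.

Record pcoalg := PCoalg {
  pc :> coalg;
  pt : hom Ibar pc }.

Lemma C_eq (A : alg C) (x y : A) : le x y -> x = y.
Proof. exact: le_discrete (C_unordered S) _ _. Qed.

Lemma C_hom (A B : alg C) (f : A -> B) :
  (forall (o : op C) (u : 'I_(ar o) -> A), f (opn u) = opn (fun i => f (u i))) ->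
  is_hom f.
Proof. by move=> fP; split=> // x y /C_eq->; exact: le_refl. Qed.

Definition rho_car := {K : seq X0 -> bool | regular K}.

Lemma rho_ext (K K' : rho_car) : sval K =1 sval K' -> K = K'.
Proof. by case: K K' => [K rK] [K' rK'] /= /funext e; exact: eq_exist. Qed.

Notation toY := (to_bool (Ybar_bool S)).
Notation ofY := (of_bool (Ybar_bool S)).

Lemma regular_opn (o : op C) (K : 'I_(ar o) -> rho_car) :
  regular (fun w => toY (opn (fun i => ofY (sval (K i) w)))).
Proof.
exact: (@regular_bool _ (fun u => toY (opn (fun i => ofY (u i))))
  _ (fun i => svalP (K i))).
Qed.

Definition rho_opn (o : op C) (K : 'I_(ar o) -> rho_car) : rho_car :=
  exist _ _ (regular_opn K).

Lemma rho_eval (v : nat -> rho_car) t w :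
  ofY (sval (eval rho_opn v t) w) = eval (@opn _ Ybar) (fun n => ofY (sval (v n) w)) t.
Proof.
elim: t => //= o ts IH; rewrite to_boolK; congr opn.
by apply: funext => i; exact: IH.
Qed.

Lemma rho_sat s t : ineq s t ->
  forall v, eval rho_opn v s = eval rho_opn v t.
Proof.
move=> st v; apply: rho_ext => w; apply: (can_inj (of_boolK (Ybar_bool S))).
by rewrite !rho_eval; apply: C_eq; exact: alg_sat.
Qed.

Lemma rho_opn_mono (o : op C) (u v : 'I_(ar o) -> rho_car) :
  (forall i, u i = v i) -> rho_opn u = rho_opn v.
Proof. by move=> /funext->. Qed.

(** The operations are those of the power of [Ybar], i.e. pointwise. *)
Definition rho_alg : alg C :=
  @Alg C rho_car eq rho_opn (@erefl _) (fun y x z => @etrans _ x y z)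
    (fun x y xy _ => xy) (fun _ x y xy => xy) rho_opn_mono rho_sat.

Definition rho_gam_fun (a : X0) (K : rho_alg) : rho_alg :=
  exist _ (fun w => sval K (a :: w)) (regular_deriv a (svalP K)).

Lemma is_hom_rho_gam a : is_hom (rho_gam_fun a).
Proof. by apply: C_hom => o u; exact: rho_ext. Qed.

Lemma is_hom_rho_out : is_hom (fun K : rho_alg => ofY (sval K [::]) : Ybar).
Proof. by apply: C_hom => o u /=; rewrite to_boolK. Qed.

Definition rhoT : coalg :=
  Coalg (fun a => Hom (is_hom_rho_gam a)) (Hom is_hom_rho_out).

Definition rev_state (L : hom Xstar Y) (rL : regular (restr L)) : rhoT :=
  exist _ (restr (rev_lang L)) (regular_rev_lang rL).

(** A subcoalgebra of [rhoT] is a pair of [V] and an injective [m : V -> rhoT]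
    (homomorphisms into [rhoT] are unique, see [rhoT_hom_unique]). *)
Definition smallest_subcoalg (r : rhoT) (V : coalg) (m : coalg_hom V rhoT) : Prop :=
  [/\ injective m, exists v, m v = r &
      forall (W : coalg) (n : coalg_hom W rhoT),
        injective n -> (exists w, n w = r) ->
        forall v, exists w, n w = m v].

Definition dual_automaton (V : pcoalg) (finV : finite_set [set: V]) : automaton :=
  let Q := FAlg finV in
  @Automaton (F0 (dual S) Q)
    (fun a => F1 (A := Q) (B := Q) (dual S) (gam V a))
    (hcomp (F1 (A := Q) (dual S) (out V)) (fwd (dualI S)))
    (hcomp (fwd (dualY S)) (F1 (A := Ibar) (B := Q) (dual S) (pt V))).

Definition crun (Q : coalg) (q : Q) (w : seq X0) : Q :=
  foldl (fun q a => gam Q a q) q w.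

Definition clang (Q : coalg) (q : Q) (w : seq X0) : bool := toY (out Q (crun q w)).

Lemma clang_rho (K : rhoT) : clang K =1 sval K.
Proof.
move=> w; rewrite /clang /= of_boolK.
elim: w K => //= a w IH K; exact: IH.
Qed.

Lemma clang_hom (Q R : coalg) (h : coalg_hom Q R) q : clang (h q) = clang q.
Proof.
apply: funext => w; rewrite /clang -(ch_out h); congr (toY (out R _)).
by elim: w q => //= a w IH q; rewrite -(ch_gam h) IH.
Qed.

Lemma rhoT_hom_unique (Q : coalg) (h h' : coalg_hom Q rhoT) : h =1 h'.
Proof.
by move=> q; apply: rho_ext => w; rewrite -!clang_rho !clang_hom.
Qed.

Lemma is_hom_crun (Q : coalg) w : is_hom (fun q : Q => crun q w).
Proof.
elim: w => [|a w IH]; first exact: is_hom_id.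
exact: is_hom_comp IH (homP (gam Q a)).
Qed.

Lemma clang_regular (Q : coalg) (q : Q) : finite_set [set: Q] -> regular (clang q).
Proof.
move=> fQ; apply/regular_dfa.
exact: (finite_dfa fQ q (fun q a => gam Q a q) (fun q => toY (out Q q))).
Qed.

Section ToRho.
Variables (Q : coalg) (fQ : finite_set [set: Q]).
Definition to_rho_fun (q : Q) : rhoT := exist _ (clang q) (clang_regular q fQ).
Lemma is_hom_to_rho : is_hom to_rho_fun.
Proof.
apply: C_hom => o u; apply: rho_ext => w /=; rewrite /clang.
rewrite (is_hom_crun Q w).2 (homP (out Q)).2; congr (toY (opn _)).
by apply: funext => i; rewrite to_boolK.
Qed.
Lemma to_rho_gam a q : to_rho_fun (gam Q a q) = gam rhoT a (to_rho_fun q).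
Proof. exact: rho_ext. Qed.
Lemma to_rho_out q : out rhoT (to_rho_fun q) = out Q q.
Proof. by rewrite /= to_boolK. Qed.
Definition to_rho : coalg_hom Q rhoT :=
  @CoalgHom Q rhoT (Hom is_hom_to_rho) to_rho_gam to_rho_out.
End ToRho.

Section SubCoalg.
Variables (Q : coalg) (P : set Q).
Hypotheses (clP : closed P) (gamP : forall a q, P q -> P (gam Q a q)).
Let B := sub_alg clP.
Let gam_val a : hom B Q := hcomp (gam Q a) (sub_val clP).
Definition sub_coalg : coalg :=
  @Coalg B (fun a => Hom (is_hom_lift clP (f := gam_val a) (fun x => gamP a (svalP x))))
    (hcomp (out Q) (sub_val clP)).
Definition sub_coalg_val : coalg_hom sub_coalg Q :=
  @CoalgHom sub_coalg Q (sub_val clP) (fun a q => erefl) (fun q => erefl).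
Lemma sub_coalg_finite : finite_set P -> finite_set [set: sub_coalg].
Proof.
move=> fP; have := @finite_preimage _ _ P (@sval Q P).
have -> : @sval Q P @^-1` P = setT.
  by rewrite predeqE => -[x Px]; split.
by apply=> // x y _ _; exact: sval_inj_sub.
Qed.

Lemma sub_coalg_lift (R : coalg) (h : coalg_hom R Q) (hP : forall x, P (h x)) :
  exists k : coalg_hom R sub_coalg, forall x, sub_coalg_val (k x) = h x.
Proof.
have kg a q : Hom (is_hom_lift clP hP) (gam R a q) =
    gam sub_coalg a (Hom (is_hom_lift clP hP) q).
  by apply: sval_inj_sub => /=; rewrite (ch_gam h).
have ko q : out sub_coalg (Hom (is_hom_lift clP hP) q) = out R q.
  by rewrite /= (ch_out h).
by exists (@CoalgHom R sub_coalg (Hom (is_hom_lift clP hP)) kg ko).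
Qed.
End SubCoalg.

Lemma smallest_subcoalg_exists (r : rhoT) :
  exists (V : coalg) (m : coalg_hom V rhoT), smallest_subcoalg r m.
Proof.
pose P : set rhoT := [set K | forall (W : coalg) (n : coalg_hom W rhoT),
  injective n -> (exists w, n w = r) -> exists w, n w = K].
have clP : closed P.
  move=> o u Pu W n inj_n rn.
  have [g gP] := choice (fun i => Pu i W n inj_n rn).
  by exists (opn g); rewrite (homP n).2; congr opn; apply: funext.
have gamP a K : P K -> P (gam rhoT a K).
  move=> PK W n inj_n rn; have [w <-] := PK W n inj_n rn.
  by exists (gam W a w); rewrite ch_gam.
exists (sub_coalg clP gamP), (sub_coalg_val clP gamP); split.
- by move=> x y; exact: sval_inj_sub.
- have Pr : P r by move=> W n _.
  by exists (exist _ r Pr).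
- by move=> W n inj_n rn [K PK]; exact: PK.
Qed.

Lemma finite_derivs (K : rhoT) : finite_set (range (crun K)).
Proof.
have [T [s0 [d [F KF]]]] := (regular_dfa _).1 (svalP K).
have crE w u : sval (crun K w) u = F (foldl d s0 (w ++ u)).
  rewrite -KF; elim: w K {KF} => //= a w IH K; exact: IH.
pose f (K : rhoT) : set T := [set t | forall u, sval K u = F (foldl d t u)].
pose g (t : T) : rhoT := if pselect (exists w, foldl d s0 w = t) is left e
  then crun K (sval (cid e)) else K.
apply: (@sub_finite_set _ _ (range g)); last exact/finite_image/finite_finset.
move=> _ [w _ <-]; exists (foldl d s0 w) => //; rewrite /g.
case: pselect => [e|[]]; last by exists w.
case: (cid e) => v /= vw; apply: rho_ext => u.
by rewrite !crE !foldl_cat vw.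
Qed.

Section FinSub.
Variable G : set rhoT.
Let DG : set rhoT := \bigcup_(K in G) range (crun K).
Let P : set rhoT := generated DG.

Lemma fin_sub_gam a K : P K -> P (gam rhoT a K).
Proof.
move=> PK; apply: (PK [set K | P (gam rhoT a K)]).
  move=> o u uP; rewrite /mkset (homP (gam rhoT a)).2.
  exact: closed_generated uP.
move=> _ [K' GK' [w _ <-]]; apply: sub_generated; exists K' => //.
by exists (rcons w a) => //; rewrite /crun foldl_rcons.
Qed.

Definition fin_sub : coalg := sub_coalg (@closed_generated _ _ DG) fin_sub_gam.
Definition fin_sub_val : coalg_hom fin_sub rhoT :=
  sub_coalg_val (@closed_generated _ _ DG) fin_sub_gam.

Lemma fin_sub_mem K : G K -> exists q, fin_sub_val q = K.
Proof.
move=> GK; have PK : P K.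
  by apply: sub_generated; exists K => //; exists [::].
by exists (exist _ K PK).
Qed.

Lemma fin_sub_least (Q : set rhoT) : closed Q ->
  (forall a K, Q K -> Q (gam rhoT a K)) -> G `<=` Q ->
  forall q, Q (fin_sub_val q).
Proof.
move=> clQ gQ GQ [K PK] /=; apply: PK => // _ [K' /GQ QK' [w _ <-]].
by elim: w K' QK' => //= a w IH K' QK'; exact/IH/gQ.
Qed.

Lemma fin_sub_finite : finite_set G -> finite_set [set: fin_sub].
Proof.
move=> fG; have fDG : finite_set DG.
  by apply: bigcup_finite => // K _; exact: finite_derivs.
pose H : set fin_sub := [set q | DG (fin_sub_val q)].
apply: (C_lf S fin_sub H).
  by apply: finite_preimage => // x y _ _; exact: sval_inj_sub.
rewrite predeqE => -[K PK]; split=> // _ R clR HR.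
have [PK' RK] : exists PK : P K, R (exist _ K PK).
  apply: (PK [set K | exists PK : P K, R (exist _ K PK)]).
    move=> o u uR; eexists.
    exact: (clR o (fun i => exist _ (u i) (projT1 (cid (uR i))))
      (fun i => projT2 (cid (uR i)))).
  move=> K' DK'; exists (sub_generated DK'); exact: HR.
by rewrite (Prop_irrelevance PK PK').
Qed.
End FinSub.
Arguments fin_sub_val {G}.

Lemma rhoT_colimit (Z : coalg)
    (c : forall Q : coalg, finite_set [set: Q] -> coalg_hom Q Z) :
  (forall (Q R : coalg) (fQ : finite_set [set: Q]) (fR : finite_set [set: R])
     (h : coalg_hom Q R) q, c R fR (h q) = c Q fQ q) ->
  exists k : coalg_hom rhoT Z,
    (forall (Q : coalg) (fQ : finite_set [set: Q]) q,
       k (to_rho fQ q) = c Q fQ q) /\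
    (forall k' : coalg_hom rhoT Z,
       (forall (Q : coalg) (fQ : finite_set [set: Q]) q,
          k' (to_rho fQ q) = c Q fQ q) -> k' =1 k).
Proof.
move=> cP.
pose fs1 (K : rhoT) := fin_sub_finite (finite_set1 K).
pose el (K : rhoT) : fin_sub [set K] := sval (cid (fin_sub_mem (erefl K : [set K] K))).
have elP K : fin_sub_val (el K) = K by rewrite /el; case: cid.
pose k0 (K : rhoT) : Z := c _ (fs1 K) (el K).
have k0P (Q : coalg) (fQ : finite_set [set: Q]) (h : coalg_hom Q rhoT) q :
    k0 (h q) = c Q fQ q.
  pose Im : set rhoT := range h.
  have clIm : closed Im.
    move=> o u uIm; have /choice[g gP] : forall i, exists x, h x = u i.
      by move=> i; have [x _ <-] := uIm i; exists x.
    by exists (opn g) => //; rewrite (homP h).2; congr opn; apply: funext.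
  have gIm a K : Im K -> Im (gam rhoT a K).
    by move=> [x _ <-]; exists (gam Q a x) => //; rewrite ch_gam.
  have fIm : finite_set [set: sub_coalg clIm gIm].
    by apply: sub_coalg_finite; exact: finite_image.
  have [p pP] : exists p : coalg_hom Q (sub_coalg clIm gIm),
      forall x, sub_coalg_val clIm gIm (p x) = h x.
    by apply: sub_coalg_lift => x; exists x.
  have [j jP] : exists j : coalg_hom (fin_sub [set h q]) (sub_coalg clIm gIm),
      forall x, sub_coalg_val clIm gIm (j x) = fin_sub_val x.
    apply: sub_coalg_lift => x; apply: fin_sub_least => // _ ->.
    by exists q.
  rewrite /k0 -(cP _ _ fQ fIm p) -(cP _ _ (fs1 (h q)) fIm j); congr (c _ fIm _).
  apply: sval_inj_sub.
  exact: etrans (etrans (jP (el (h q))) (elP (h q))) (esym (pP q)).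
have k0op (o : op C) (u : 'I_(ar o) -> rhoT) :
    k0 (opn u) = opn (fun i => k0 (u i)).
  have fG : finite_set (range u) by apply: finite_image; exact: finite_finset.
  have /choice[g gP] : forall i, exists x : fin_sub (range u), fin_sub_val x = u i.
    by move=> i; apply: fin_sub_mem; exists i.
  have -> : opn u = fin_sub_val (opn g).
    by rewrite (homP (fin_sub_val)).2; congr opn; apply: funext.
  rewrite (k0P _ (fin_sub_finite fG)) (homP (c _ _)).2; congr opn.
  by apply: funext => i; rewrite -gP (k0P _ (fin_sub_finite fG)).
have k0g a K : k0 (gam rhoT a K) = gam Z a (k0 K).
  by rewrite -{1}(elP K) -ch_gam (k0P _ (fs1 K)) ch_gam.
have k0o K : out Z (k0 K) = out rhoT K by rewrite /k0 ch_out -[in RHS](elP K).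
exists (@CoalgHom rhoT Z (Hom (C_hom k0op)) k0g k0o); split.
  by move=> Q fQ q; exact: k0P.
move=> k' k'P K /=; rewrite /k0 -k'P; congr (k' _).
by rewrite (rhoT_hom_unique (to_rho (fs1 K)) fin_sub_val) elP.
Qed.

End Automata.

(* Main.v *)
(** Write [A] for the dual of [V]. By duality, running [A] on [w] from its initial
    state is dual to running [V] on [rev w], so [A] accepts [L].
    Reachability: distinct states of [V] accept distinct languages, and dually
    the map [X* -> A], [w |-> delta_w(i)], is an epimorphism, hence surjective.
    Simplicity: [V] is generated as an algebra by the derivatives of its point;
    dually, the map sending a state of [A] to the morphism [X* -> Y] that it
    accepts is an isomorphism onto its image, hence an order embedding. *)
Require Import Defs.
From mathcomp Require Import all_boot.
From mathcomp Require Import boolp classical_sets functions cardinality.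

Set Implicit Arguments.
Unset Strict Implicit.
Unset Printing Implicit Defensive.

Local Open Scope classical_set_scope.

(** * Generation, finiteness and epimorphisms in a variety *)

Section Algebras.
Variable V : variety.

Lemma hom_eq (A B : alg V) (f g : hom A B) : f = g -> f =1 g.
Proof. by move=> ->. Qed.

Lemma psi_hom_le (T : Type) (A : alg V) (f g : Psi V T -> A) :
  is_hom f -> is_hom g -> (forall t, le (f (eta V t)) (g (eta V t))) ->
  forall x, le (f x) (g x).
Proof.
move=> fP gP fg x.
have : generated (range (@eta V T)) x by rewrite psi_generated.
move=> /(_ [set x | le (f x) (g x)]); apply=> [o u uP|_ [t _ <-]]; last exact: fg.
by rewrite /mkset fP.2 gP.2; apply: opn_mono.
Qed.

Lemma closed_range (A B : alg V) (f : hom A B) : Defs.closed (range f).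
Proof.
move=> o u uP; have /choice[g gP] : forall i, exists x, f x = u i.
  by move=> i; have [x _ <-] := uP i; exists x.
by exists (opn g) => //; rewrite (homP f).2; congr opn; apply: funext.
Qed.

Lemma finite_sub_alg (A : alg V) (P : set A) (clP : Defs.closed P) :
  finite_set P -> finite_set [set: sub_alg clP].
Proof.
move=> fP; have := @finite_preimage _ _ P (@sval A P).
have -> : @sval A P @^-1` P = setT by rewrite predeqE => -[x Px]; split.
by apply=> // x y _ _; exact: sval_inj_sub.
Qed.

Lemma finite_generated (A : alg V) (G : set A) :
  locally_finite V -> finite_set G ->
  finite_set [set: sub_alg (@closed_generated V A G)].
Proof.
move=> lf fG; pose B := sub_alg (@closed_generated V A G).
pose H : set B := [set x | G (sval x)].
apply: (lf B H).
  by apply: finite_preimage => // x y _ _; exact: sval_inj_sub.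
rewrite predeqE => -[x Gx]; split=> // _ R clR HR.
(* [R] lives on the subalgebra, so the induction over [generated G] carries the membership proof
   along. *)
have [Gx' Rx] : exists Gx : generated G x, R (exist _ x Gx).
  apply: (Gx [set x | exists Gx : generated G x, R (exist _ x Gx)]).
    move=> o u uR; eexists.
    exact: (clR o (fun i => exist _ (u i) (projT1 (cid (uR i))))
      (fun i => projT2 (cid (uR i)))).
  by move=> y Gy; exists (sub_generated Gy); exact: HR.
by rewrite (Prop_irrelevance Gx Gx').
Qed.

(* The subalgebra generated by the two images is finite. *)
Lemma epi_finite (lf : locally_finite V) (A B : alg V) (e : hom A B) :
  finite_set [set: B] ->
  (forall (C : falg V) (g h : hom B C), hcomp g e = hcomp h e -> g = h) ->
  epi e.
Proof.
move=> fB eP C g h ge.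
pose G : set C := range g `|` range h.
have fG : finite_set G by rewrite finite_setU; split; exact: finite_image.
have gG x : generated G (g x) by apply: sub_generated; left; exists x.
have hG x : generated G (h x) by apply: sub_generated; right; exists x.
pose cl := @closed_generated V C G.
have := eP (FAlg (finite_generated lf fG)) (Hom (is_hom_lift cl gG))
  (Hom (is_hom_lift cl hG)).
have ge' : hcomp (Hom (is_hom_lift cl gG)) e = hcomp (Hom (is_hom_lift cl hG)) e.
  by apply: hom_ext => x; apply: sval_inj_sub; exact: (hom_eq ge x).
move=> /(_ ge') gh; apply: hom_ext => x.
exact: (congr1 sval (hom_eq gh x)).
Qed.

End Algebras.

(** * Faithfulness and fullness of the dual equivalence *)

Section Duality.
Variables (C D : variety) (E : dual_equivalence C D).

Lemma F1_faithful (A B : falg C) (f g : hom A B) : F1 E f = F1 E g -> f = g.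
Proof.
move=> fg; apply: hom_ext => x; apply: (can_inj (fwdK (unit_iso E B))).
apply: etrans (hom_eq (unit_nat E f) x) _.
by rewrite fg -(unit_nat E g).
Qed.

Lemma G1_faithful (A B : falg D) (f g : hom A B) : G1 E f = G1 E g -> f = g.
Proof.
move=> fg; apply: hom_ext => x; apply: (can_inj (fwdK (counit_iso E B))).
apply: etrans (hom_eq (counit_nat E f) x) _.
by rewrite fg -(counit_nat E g).
Qed.

(** The preimage [f] is [G1 g] transported along the units; naturality gives [G1 (F1 f) = G1 g], and
    [G1] is faithful. *)
Lemma F1_full (A B : falg C) (g : hom (F0 E B) (F0 E A)) :
  exists f : hom A B, F1 E f = g.
Proof.
exists (hcomp (bwd (unit_iso E B)) (hcomp (G1 E g) (fwd (unit_iso E A)))).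
apply: G1_faithful; apply: hom_ext => y; rewrite -(bwdK (unit_iso E A) y).
set f := hcomp _ _; apply: etrans (esym (hom_eq (unit_nat E f) _)) _.
by rewrite /= !bwdK.
Qed.

End Duality.

(** * Reachability and observation morphisms of an automaton *)

Section Automata.
Variables (S : setting) (X0 : finType).
Notation D := (varD S).
Notation C := (varC S).
Notation Y := (Y S).
Notation Ybar := (Ybar S).
Notation Xstar := (Xstar S X0).
Implicit Types (A B : automaton S X0) (L : hom Xstar Y).

Lemma Y_bool_inj : injective (Y_bool S).
Proof. exact: can_inj (to_boolK _). Qed.

Section Reach.
Variable A : automaton S X0.

Lemma is_hom_reach :
  is_hom (fun x : Xstar => (trans A x : hom A A) (ini A (genI S))).
Proof.
split=> [x y xy|o u]; first exact: (homP (trans A)).1 x y xy _.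
by rewrite (homP (trans A)).2.
Qed.
Definition reach : hom Xstar A := Hom is_hom_reach.

Lemma reach_eta w : reach (eta D w) = run (ini A (genI S)) w.
Proof. exact: (hom_eq (trans_homE A w)). Qed.

Lemma is_hom_obs_state (q : A) :
  is_hom (fun x : Xstar => fin A ((trans A x : hom A A) q)).
Proof.
split=> [x y xy|o u]; first exact/(homP (fin A)).1/((homP (trans A)).1 x y xy).
by rewrite (homP (trans A)).2 /= (homP (fin A)).2.
Qed.
Definition obs_state (q : A) : hom Xstar Y := Hom (is_hom_obs_state q).

Lemma obs_state_eta q w : obs_state q (eta D w) = fin A (run q w).
Proof. exact (congr1 (fin A) (hom_eq (trans_homE A w) q)). Qed.

Lemma is_hom_obs : is_hom (obs_state : A -> hom_alg (D_comm S) Xstar Y).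
Proof.
split=> [q q' qq' x|o u].
  exact/(homP (fin A)).1/(homP (trans A x : hom A A)).1.
apply: hom_ext => x /=.
by rewrite (homP (trans A x : hom A A)).2 (homP (fin A)).2.
Qed.
(** Commutativity of [D] makes [[X*,Y]] an algebra with pointwise order; [simple A] then says that
    [obs] reflects the order. *)
Definition obs : hom A (hom_alg (D_comm S) Xstar Y) := Hom is_hom_obs.

Lemma obs_le q q' : (forall w, le (fin A (run q w)) (fin A (run q' w))) ->
  le (obs q) (obs q').
Proof.
move=> qq'; apply: (psi_hom_le (homP (obs_state q)) (homP (obs_state q'))) => w.
by rewrite !obs_state_eta.
Qed.

Lemma fin_reach L : lang A =1 restr L -> forall x, fin A (reach x) = L x.
Proof.
move=> AL; apply: psi_uniq => [||w].
- exact: is_hom_comp (homP (fin A)) (homP reach).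
- exact: homP.
by apply: Y_bool_inj; rewrite reach_eta; exact: AL.
Qed.

(** Composition in [end_mon] is diagrammatic, so acting by [x] and then by [w] is acting by their
    product in this order. *)
Lemma run_reach x w : run (reach x) w = reach (dm_mul x (eta D w)).
Proof.
have xw := hom_eq (trans_mul A x (eta D w)) (ini A (genI S)).
exact (esym (etrans xw (hom_eq (trans_homE A w) _))).
Qed.

End Reach.

(** * Uniqueness of the minimal automaton *)

(** The output after [reach x] and then [w] is [L] at the product of [x] and [w], whatever the
    automaton. Simplicity of [B] turns this into both well-definedness and monotonicity of [h]. *)
Lemma reachable_simple_hom L A B : lang A =1 restr L -> lang B =1 restr L ->
  reachable A -> simple B ->
  exists h : hom A B, forall x, h (reach A x) = reach B x.
Proof.
move=> AL BL rA sB; have /choice[c cP] := rA.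
have leAB x y : le (reach A x) (reach A y) -> le (reach B x) (reach B y).
  move=> xy; apply: sB => w.
  rewrite !run_reach !(fin_reach BL) -!(fin_reach AL) -!run_reach.
  by apply/(homP (fin A)).1/(is_hom_run A w).1.
have eqAB x y : reach A x = reach A y -> reach B x = reach B y.
  by move=> xy; apply: le_anti; apply: leAB; rewrite xy; exact: le_refl.
have hP : is_hom (fun q => reach B (c q)).
  split=> [q q' qq'|o u].
    by apply: leAB; move: qq'; rewrite {1}(cP q) {1}(cP q').
  rewrite -(homP (reach B)).2; apply: eqAB; rewrite -[LHS]cP (homP (reach A)).2.
  by congr opn; apply: funext => i; exact: cP.
by exists (Hom hP) => x; apply: eqAB; rewrite -[LHS]cP.
Qed.

Lemma minimal_automaton_unique L A B :
  minimal_automaton L A -> minimal_automaton L B -> automaton_iso A B.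
Proof.
move=> [AL rA sA] [BL rB sB].
have [h hP] := reachable_simple_hom AL BL rA sB.
have [k kP] := reachable_simple_hom BL AL rB sA.
have hK : cancel h k by move=> q; have [x ->] := rA q; rewrite hP kP.
have kK : cancel k h by move=> q; have [x ->] := rB q; rewrite kP hP.
exists (Iso hK kK); split=> [a q||q] /=.
- have [x ->] := rA q.
  rewrite -[delta A a _]/(run (reach A x) [:: a]) -/(reach A x) hP.
  by rewrite -[delta B a _]/(run (reach B x) [:: a]) !run_reach hP.
- by have := hP (eta D [::]); rewrite !reach_eta.
- by have [x ->] := rA q; rewrite -/(reach A x) hP (fin_reach AL) (fin_reach BL).
Qed.

(** * Finiteness of the smallest subcoalgebra *)

(** By minimality the image lies in the subalgebra generated by the finitely many derivatives of
    [r], which is finite by local finiteness. *)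
Lemma smallest_subcoalg_finite (r : rhoT S X0) (Q : coalg S X0)
    (m : coalg_hom Q (rhoT S X0)) :
  smallest_subcoalg r m -> finite_set [set: Q].
Proof.
move=> [m_inj _ m_min].
have fF := fin_sub_finite (finite_set1 r).
have sub : range m `<=` range (@fin_sub_val S X0 [set r]).
  move=> _ [v _ <-].
  have [|w <-] := m_min _ (fin_sub_val [set r]) (@sval_inj_sub _ _ _) _ v.
    exact: fin_sub_mem.
  by exists w.
have fR : finite_set (range m) := sub_finite_set sub (finite_image _ fF).
have -> : [set: Q] = m @^-1` range m by rewrite predeqE => v; split=> // _; exists v.
by apply: finite_preimage => // x y _ _; exact: m_inj.
Qed.

Definition crun_hom (Q : coalg S X0) w : hom Q Q := Hom (is_hom_crun Q w).

(** * Language, reachability and simplicity of the dual automaton *)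

Section Dual.
Variables (r : rhoT S X0) (V : pcoalg S X0) (m : coalg_hom V (rhoT S X0)).
Hypotheses (V_smallest : smallest_subcoalg r m) (V_pointed : m (pt V (genIbar S)) = r).
Hypothesis finV : finite_set [set: V].
Let Q : falg C := FAlg finV.
Let A : automaton S X0 := dual_automaton finV.
Let F1 := F1 (dual S).

(** Contravariance reverses composites, hence the order in which letters act. *)
Lemma dual_run w (q : A) : run q w = F1 (A := Q) (B := Q) (crun_hom V (rev w)) q.
Proof.
elim/last_ind: w q => [|w a IH] q.
  rewrite -[LHS]/(hid (F0 (dual S) Q) q) -(F1_id (dual S) Q).
  by congr (Defs.F1 _ _ q); exact: hom_ext.
rewrite /run foldl_rcons -/(run q w) IH rev_rcons.
have -> : crun_hom V (a :: rev w) = hcomp (crun_hom V (rev w)) (gam V a).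
  exact: hom_ext.
by rewrite /F1 (F1_comp (dual S) (A1 := Q) (A2 := Q) (A3 := Q)).
Qed.

Lemma dual_lang w : lang A w = clang (pt V (genIbar S)) (rev w).
Proof.
rewrite /lang dual_run.
pose Ib : falg C := free1 (C_lf S).
(* The acceptance bit as a morphism from [Ibar] to [Ybar]: [bool_compat] equates it with the bit of
   its dual. *)
pose h : hom Ib Ybar := hcomp (out V) (hcomp (crun_hom V (rev w)) (pt V)).
rewrite -[RHS](bool_compat h) /h.
rewrite (F1_comp (dual S) (A1 := Ib) (A2 := Q) (A3 := Ybar)).
by rewrite (F1_comp (dual S) (A1 := Ib) (A2 := Q) (A3 := Q)).
Qed.

(** The injection [m] sends each state to its language. *)
Lemma clang_inj (q q' : V) : clang q =1 clang q' -> q = q'.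
Proof.
have [m_inj _ _] := V_smallest => qq'; apply: m_inj; apply: rho_ext => w.
by rewrite -!clang_rho !clang_hom.
Qed.

Lemma reach_epi : epi (reach A).
Proof.
apply: epi_finite (D_lf S) _ _ _ _ _; first exact: falg_fin (F0 (dual S) Q).
move=> B g h gh.
pose c := counit_iso (dual S) B.
have [g' gE] := F1_full (hcomp (fwd c) g : hom (F0 (dual S) Q) _).
have [h' hE] := F1_full (hcomp (fwd c) h : hom (F0 (dual S) Q) _).
suff e : g' = h'.
  apply: hom_ext => q; apply: (can_inj (fwdK c)).
  by rewrite -[LHS](hom_eq gE q) -[RHS](hom_eq hE q) e.
apply: hom_ext => x; apply: clang_inj => w.
(* [k f] records at [x] whether the state [f x] accepts [w]. *)
pose k (f : hom (G0 (dual S) B) Q) : hom (G0 (dual S) B) Ybar :=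
  hcomp (out V) (hcomp (crun_hom V w) f).
suff e : k g' = k h' by congr (Ybar_bool S _); exact: (hom_eq e x).
apply: (F1_faithful (E := dual S)).
have kE (f : hom (G0 (dual S) B) Q) y : F1 (B := Ybar) (k f) y =
    F1 f (F1 (A := Q) (B := Q) (crun_hom V w) (F1 (A := Q) (out V) y)).
  rewrite /k /F1 (F1_comp (dual S) (A2 := Q)).
  by rewrite (F1_comp (dual S) (A2 := Q) (A3 := Q)).
(* It suffices to compare at the generator of [I], where the sides are, up to [c], the values of [g]
   and [h] at the state reached by [rev w]. *)
have e : forall z, F1 (B := Ybar) (k g') (fwd (dualI S) z) =
    F1 (B := Ybar) (k h') (fwd (dualI S) z).
  apply: psi_uniq => [||t].
  - exact: is_hom_comp (homP _) (homP _).
  - exact: is_hom_comp (homP _) (homP _).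
  rewrite !kE /F1 gE hE /=; congr (fwd c _).
  have : g (reach A (eta D (rev w))) = h (reach A (eta D (rev w))).
    exact: (hom_eq gh (eta D (rev w))).
  by rewrite reach_eta dual_run revK; case: t.
by apply: hom_ext => y; have := e (bwd (dualI S) y); rewrite bwdK.
Qed.

Lemma dual_reachable : reachable A.
Proof. by move=> q; have [x <-] := D_epi S _ _ _ reach_epi q; exists x. Qed.

(** Each [gam V a] is a morphism, so this subalgebra is a subcoalgebra containing the point;
    minimality of [V] applies. *)
Lemma pt_generates : generated (range (crun (pt V (genIbar S)))) = [set: V].
Proof.
set G := range _; have gP a q : generated G q -> generated G (gam V a q).
  move=> Gq; apply: (Gq [set q | generated G (gam V a q)]) => [o u uP|_ [w _ <-]].
    rewrite /mkset (homP (gam V a)).2; exact: closed_generated uP.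
  apply: sub_generated; exists (rcons w a) => //.
  by rewrite /crun foldl_rcons.
pose W := sub_coalg (@closed_generated _ V G) gP.
pose n0 := sub_coalg_val (@closed_generated _ V G) gP.
have n1 a q : hcomp m n0 (gam W a q) = gam (rhoT S X0) a (hcomp m n0 q).
  exact: (ch_gam m).
have n2 q : out (rhoT S X0) (hcomp m n0 q) = out W q by exact: (ch_out m).
have [m_inj _ m_min] := V_smallest.
rewrite predeqE => v; split=> // _.
have Gpt : generated G (pt V (genIbar S)) by apply: sub_generated; exists [::].
have [||[x Gx] /m_inj <- //] := m_min W (CoalgHom n1 n2) _ _ v.
- by move=> x y /m_inj; exact: sval_inj_sub.
- by exists (exist _ _ Gpt).
Qed.

(** The image of [obs], unlike [[X*,Y]] in general, is finite, so it has a dual. *)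
Let E := sub_alg (closed_range (f := obs A)).
Let obsP q : range (obs A) (obs A q). Proof. by exists q. Qed.
Let u : hom A E := Hom (is_hom_lift (closed_range (f := obs A)) obsP).

Let finE : finite_set [set: E].
Proof. exact/finite_sub_alg/finite_image/(falg_fin (F0 (dual S) Q)). Qed.

Let u_surj (y : E) : exists q, u q = y.
Proof. by case: y => y [q qT qy]; exists q; exact: sval_inj_sub. Qed.

(* The dual of the surjection [u] is injective, and it is onto because its image
   contains the generators [crun w (pt V)] of [V]. So [u] is an isomorphism of
   (ordered) algebras. *)
Let obs_retract : exists k : hom E A, cancel u k.
Proof.
pose E' := FAlg finE; pose G := G0 (dual S) E'; pose c := counit_iso (dual S) E'.
have [u' uE] := F1_full (hcomp (fwd c) u : hom (F0 (dual S) Q) (F0 (dual S) G)).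
have u'_inj : injective u'.
  (* Elements of [G] are morphisms out of [Ibar]; their duals are compared on [F1 u'], which is onto
     because [u] is. *)
  move=> x y xy; pose p z : hom (free1 (C_lf S)) G := ext (fun=> z).
  have pE z t : p z (eta C t) = z by exact: ext_eta.
  suff pxy : p x = p y.
    by have := hom_eq pxy (eta C tt); rewrite !pE.
  apply: (F1_faithful (E := dual S)); apply: hom_ext => z.
  have [q <-] : exists q, Defs.F1 (dual S) u' q = z.
    have [q qz] := u_surj (bwd c z); exists q.
    by rewrite (hom_eq uE q) -[LHS]/(fwd c (u q)) qz bwdK.
  have upE : hcomp u' (p x) = hcomp u' (p y).
    apply: hom_ext; apply: psi_uniq => [||t]; [exact: homP|exact: homP|].
    by rewrite -[LHS]/(u' (p x (eta C t))) -[RHS]/(u' (p y (eta C t))) !pE.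
  have := hom_eq (congr1 (Defs.F1 (dual S) (A := free1 (C_lf S)) (B := Q)) upE) q.
  by rewrite !F1_comp.
have u'_surj v : range u' v.
  have : generated (range (crun (pt V (genIbar S)))) v by rewrite pt_generates.
  move=> /(_ (range u')); apply=> [|_ [w _ <-]]; first exact: closed_range.
  have obsE (q : A) : bwd (dualY S) (obs_state q (eta D (rev w))) =
      F1 (A := free1 (C_lf S)) (B := Q) (pt V)
        (F1 (A := Q) (B := Q) (crun_hom V w) q).
    by rewrite obs_state_eta dual_run revK /= fwdK.
  (* Evaluation at [rev w], read in the dual of [Ibar], dualizes to an element of [G]; by [obsE],
     [u'] sends it to [crun w (pt V)]. *)
  have tP : is_hom (fun y : E => bwd (dualY S) (sval y (eta D (rev w)))).
    apply: is_hom_comp; first exact: homP.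
    by split=> [x y xy|//]; exact: xy.
  have [s sE] := F1_full (hcomp (Hom tP) (bwd c) :
    hom (F0 (dual S) G) (F0 (dual S) (free1 (C_lf S)))).
  exists (s (genIbar S)) => //.
  have e : hcomp u' s = hcomp (crun_hom V w) (pt V).
    apply: (F1_faithful (E := dual S) (A := free1 (C_lf S)) (B := Q)).
    rewrite (F1_comp (dual S) (A2 := G) (A3 := Q)) sE uE.
    rewrite (F1_comp (dual S) (A2 := Q) (A3 := Q)).
    apply: hom_ext => q.
    rewrite -[LHS]/(bwd (dualY S) (sval (bwd c (fwd c (u q))) (eta D (rev w)))).
    rewrite fwdK; exact: obsE.
  exact: (hom_eq e).
have /choice[k kP] : forall v, exists x, u' x = v.
  by move=> v; have [x _ <-] := u'_surj v; exists x.
(* [C] is unordered, so the inverse of a bijective morphism is a morphism; in an ordered variety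
   this may fail. *)
have k_hom : is_hom k.
  apply: C_hom => o v; apply: u'_inj; rewrite kP (homP u').2; congr opn.
  by apply: funext => i; rewrite kP.
(* [F1 u'] is [u] followed by [c], so dualizing the identity [u' (k v) = v] retracts [u]. *)
exists (hcomp (F1 (A := Q) (B := G) (Hom k_hom)) (fwd c)) => q.
rewrite /= -[fwd c _]/(hcomp (fwd c) u q) -uE.
rewrite -[LHS]/(hcomp (F1 (A := Q) (B := G) (Hom k_hom)) _ q) /F1 -F1_comp.
have -> : hcomp u' (Hom k_hom) = hid Q by apply: hom_ext.
by rewrite F1_id.
Qed.

(** The retraction is monotone and carries comparisons of languages back to states. *)
Lemma dual_simple : simple A.
Proof.
move=> q q' /obs_le qq'; have [k kK] := obs_retract.
by rewrite -(kK q) -(kK q'); apply: (homP k).1.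
Qed.

End Dual.
End Automata.

Theorem theorem6p11 (S : setting) (X0 : finType) (L : hom (Xstar S X0) (Y S))
    (L_regular : regular S (restr L))
    (V : pcoalg S X0) (m : coalg_hom V (rhoT S X0))
    (V_smallest : smallest_subcoalg (rev_state L_regular) m)
    (V_pointed : m (pt V (genIbar S)) = rev_state L_regular) :
  exists finV : finite_set [set: V]%classic,
    (exists M : automaton S X0, minimal_automaton L M) /\
    (forall M : automaton S X0, minimal_automaton L M ->
       automaton_iso (dual_automaton finV) M).
Proof.
have finV := smallest_subcoalg_finite V_smallest.
have minV : minimal_automaton L (dual_automaton finV).
  split; [move=> w|exact: dual_reachable V_smallest _|].
    (* The reversal caused by duality cancels the one in [rev_lang]. *)
    rewrite dual_lang -(clang_hom m) V_pointed clang_rho /=.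
    by rewrite restr_rev revK.
  exact: dual_simple V_smallest V_pointed _.
exists finV; split; first by exists (dual_automaton finV).
by move=> M; exact: minimal_automaton_unique.
Qed.
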